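(* Let $G_1=(V,E_1)$ and $G_2=(V,E_2)$ be graphs on the same finite vertex set $V$ whose adjacency matrices $A_1,A_2$ belong to an association scheme $\mathcal{S}=\{I,A_1,A_2,\dots,A_d\}$ with first eigenmatrix $P$, and let $k_1,k_2$ be the degrees of the regular graphs $G_1,G_2$. Then $$\alpha_{\mathrm{GW}}\le\frac{\mathrm{qp}(G_1,G_2)}{\frac{|V|}{2}\cdot\left((k_1+k_2)+\max_{0\le l\le d}\{P_{l2}-P_{l1}\}\right)}\le1.$$
   Context: Graphs are finite, simple, undirected and loopless. For $G_1=(V,E_1)$, $G_2=(V,E_2)$ define $$\mathrm{qp}(G_1,G_2)=\max\Big\{\sum_{ij\in E_1}(1-x_ix_j)+\sum_{ij\in E_2}(1+x_ix_j) : x\in\mathbb{R}^V,\ x_i^2=1\text{ for all }i\in V\Big\}.$$ The Goemans–Williamson constant is $\alpha_{\mathrm{GW}}=\min_{0<\theta\le\pi}\frac2\pi\frac{\theta}{1-\cos\theta}\approx0.878$. An association scheme is a set $\{A_0,A_1,\dots,A_d\}$ of nonzero symmetric square matrices with entries in $\{0,1\}$ (indexed here by $V$) such that: (1) $\sum_iA_i=J$, the all-ones matrix; (2) any $A_i$ with a nonzero diagonal entry is a diagonal matrix; (3) there are nonnegative integers $p_{ij}^l$ with $A_iA_j=\sum_{l=0}^dp_{ij}^lA_l$ for all $i,j$. These conditions imply that the matrices commute and that the identity is one of them; we take $A_0=I$. The span of the $A_i$ has a basis of primitive idempotents $E_0=\frac1{|V|}J,E_1,\dots,E_d$ (the orthogonal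 projectors onto the common eigenspaces). The first eigenmatrix $P\in M_{d+1}(\mathbb{R})$, with rows and columns indexed by $0,\dots,d$, is defined by $A_i=\sum_{l=0}^dP_{li}E_l$. Each $A_i$ with $i\ge1$ is the adjacency matrix of a regular graph, of degree $k_i=P_{0i}$. *)

(* Defs.v *)
From HB Require Import structures.
From mathcomp Require Import all_boot all_order all_algebra.
From mathcomp Require Import ring lra.
From mathcomp Require Import all_classical all_reals all_analysis.
Set Implicit Arguments.
Unset Strict Implicit.
Unset Printing Implicit Defensive.
Import Order.TTheory GRing.Theory Num.Theory.
Import numFieldNormedType.Exports.
Local Open Scope classical_set_scope.
Local Open Scope ring_scope.

Record sgraph (V : finType) := SGraph {
  edges : {set {set V}};
  card_edge : forall e, e \in edges -> #|e| = 2%N }.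

Section Graphs.
Variables (R : realType) (V : finType).
Implicit Types G : sgraph V.

Definition regular G (k : nat) : Prop :=
  forall v, #|[set w | [set v; w]%SET \in edges G]%SET| = k.

(* The vertices are enumerated by enum_val; loops are excluded because
   [set v; v] has cardinal 1. *)
Definition adjmx G : 'M[R]_#|V| :=
  \matrix_(a, b) ([set enum_val a; enum_val b]%SET \in edges G)%:R.

(* On an edge e = {i, j} the product over e is x_i x_j. *)
Definition qp_obj G1 G2 (x : V -> R) : R :=
  \sum_(e in edges G1) (1 - \prod_(i in e) x i) +
  \sum_(e in edges G2) (1 + \prod_(i in e) x i).

(* This supremum is attained: see qp_max. *)
Definition qp G1 G2 : R :=
  sup [set qp_obj G1 G2 x | x in [set x : V -> R | forall i, x i ^+ 2 = 1]].

Lemma qp_max G1 G2 :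
  (exists2 x : V -> R, (forall i, x i ^+ 2 = 1) & qp_obj G1 G2 x = qp G1 G2) /\
  (forall x : V -> R, (forall i, x i ^+ 2 = 1) -> qp_obj G1 G2 x <= qp G1 G2).
Proof.
pose s (f : {ffun V -> bool}) (i : V) : R := (-1) ^+ f i.
have s1 f i : s f i ^+ 2 = 1 by rewrite /s -exprM mulnC exprM sqrrN !expr1n.
have sE x : (forall i, x i ^+ 2 = 1) -> exists f, x = s f.
  move=> hx; exists [ffun i => x i == -1]; apply/funext => i.
  rewrite /s ffunE; have /eqP := hx i; rewrite sqrf_eq1 => /orP[]/eqP ->.
    by rewrite eq_sym eqNr oner_eq0.
  by rewrite eqxx.
pose f0 := [arg max_(f > [ffun=> true] : {ffun V -> bool}) qp_obj G1 G2 (s f)]%O.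
have max0 f : qp_obj G1 G2 (s f) <= qp_obj G1 G2 (s f0).
  by rewrite /f0; case: arg_maxP => // g _ /(_ f isT).
have ub0 : ubound [set qp_obj G1 G2 x | x in [set x : V -> R | forall i, x i ^+ 2 = 1]]
    (qp_obj G1 G2 (s f0)).
  by move=> _ [x /= /sE[f ->] <-].
have memf f : [set qp_obj G1 G2 x | x in [set x : V -> R | forall i, x i ^+ 2 = 1]]
    (qp_obj G1 G2 (s f)) by exists (s f) => // i; exact: s1.
have qpE : qp_obj G1 G2 (s f0) = qp G1 G2.
  apply/eqP; rewrite eq_le; apply/andP; split.
    by apply: ub_le_sup => //; exists (qp_obj G1 G2 (s f0)).
  by apply: ge_sup => //; exists (qp_obj G1 G2 (s f0)).
split; first by exists (s f0).
by move=> x /sE[f ->]; rewrite -qpE.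
Qed.

End Graphs.

Section GoemansWilliamson.
Variable R : realType.

Definition gw_ratio (theta : R) : R := 2 / pi * (theta / (1 - cos theta)).

(* This infimum is attained: see alpha_GW_min. *)
Definition alpha_GW : R :=
  inf [set gw_ratio theta | theta in [set theta | 0 < theta <= pi]].

Lemma alpha_GW_min :
  (exists2 theta, 0 < theta <= pi & gw_ratio theta = alpha_GW) /\
  (forall theta, 0 < theta <= pi -> alpha_GW <= gw_ratio theta).
Proof.
have pi0 : 0 < pi :> R := pi_gt0 R.
have pi2 : 2 <= pi :> R := pi_ge2 R.
have pi4 : pi < 4 :> R by have := pihalf_lt2 R; lra.
have cpos (t : R) : 0 < t <= pi -> 0 < 1 - cos t.
  move=> /andP[t0 tp]; rewrite subr_gt0 -(cos0 R) ltr_cos // in_itv /= ?lexx ?(ltW t0) //.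
  exact: ltW.
have small (t : R) : 0 < t <= 2^-1 -> 1 <= gw_ratio t.
  move=> /andP[t0 th].
  have cp : 0 < 1 - cos t by apply: cpos; lra.
  have [c /[!in_itv]/= /andP[c0 ct] hc] :
      exists2 c, c \in `]0, t[%R & cos t - cos 0 = - sin c * (t - 0).
    apply: MVT => //; exact/continuous_subspaceT/continuous_cos.
  have [b /[!in_itv]/= /andP[b0 bc] hb] :
      exists2 b, b \in `]0, c[%R & sin c - sin 0 = cos b * (c - 0).
    apply: MVT => //; exact/continuous_subspaceT/continuous_sin.
  rewrite cos0 subr0 in hc; rewrite sin0 !subr0 in hb.
  have cb := cos_le1 b.
  have sc : sin c <= t by nra.
  have le2 : 1 - cos t <= t ^+ 2 by nra.
  rewrite /gw_ratio mulf_div ler_pdivlMr ?mul1r; last exact: mulr_gt0.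
  nra.
have gpi : gw_ratio pi = 1.
  rewrite /gw_ratio cospi opprK mulf_div [pi * _]mulrC divff // mulf_neq0 //; exact: lt0r_neq0.
have cont : {within `[2^-1, pi], continuous gw_ratio}.
  apply: continuous_in_subspaceT => t /[!inE]/=; rewrite in_itv /= => /andP[t1 t2].
  have cp : 1 - cos t != 0 by apply: lt0r_neq0; apply: cpos; lra.
  apply: cvgM; first exact: cvg_cst.
  apply: cvgM; first exact: cvg_id.
  apply: cvgV => //; apply: cvgB; first exact: cvg_cst.
  exact: continuous_cos.
have [|c /[!in_itv]/= /andP[c1 c2] cmin] := EVT_min _ cont; first by lra.
have cI : 0 < c <= pi by lra.
have lb t : 0 < t <= pi -> gw_ratio c <= gw_ratio t.
  move=> tI; have [th|th] := leP t 2^-1; last by apply: cmin; rewrite in_itv /=; lra.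
  apply: le_trans (small _ _); last lra.
  by rewrite -gpi; apply: cmin; rewrite in_itv /= lexx; lra.
have lbS : lbound [set gw_ratio theta | theta in [set theta | 0 < theta <= pi]]
    (gw_ratio c) by move=> _ [t /= tI <-]; exact: lb.
have cE : gw_ratio c = alpha_GW.
  apply/eqP; rewrite eq_le; apply/andP; split.
    by apply: lb_le_inf => //; exists (gw_ratio c), c.
  by apply: ge_inf; [exists (gw_ratio c)|exists c].
by split; [exists c|move=> t tI; rewrite -cE; exact: lb].
Qed.

End GoemansWilliamson.

(* The A i are automatically distinct: they are nonzero 0/1 matrices with sum
   the all-ones matrix. *)
Record assoc_scheme (R : realType) (n d : nat) (A : 'I_d.+1 -> 'M[R]_n) : Prop :=
  AssocScheme {
  scheme_neq0 : forall i, A i != 0;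
  scheme_sym : forall i, (A i)^T = A i;
  scheme_01 : forall i u v, (A i u v == 0) || (A i u v == 1);
  scheme_sum : \sum_i A i = const_mx 1;
  scheme_diag : forall i, (exists u, A i u u != 0) -> is_diag_mx (A i);
  scheme_mul : forall i j, exists p : 'I_d.+1 -> nat,
    A i *m A j = \sum_l (p l)%:R *: A l;
  scheme_id : A ord0 = 1%:M }.

Section Idempotents.
Variables (R : realType) (n d : nat).
Implicit Types A E : 'I_d.+1 -> 'M[R]_n.

(* The Bose-Mesner algebra of the scheme. *)
Definition scheme_span A : {vspace 'M[R]_n} := <<[seq A i | i : 'I_d.+1]>>%VS.

Definition idempotent_in (U : {vspace 'M[R]_n}) (X : 'M[R]_n) : Prop :=
  X \in U /\ X *m X = X.

Definition primitive_idempotent (U : {vspace 'M[R]_n}) (X : 'M[R]_n) : Prop :=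
  [/\ idempotent_in U X, X != 0 &
    forall Y Z, idempotent_in U Y -> idempotent_in U Z ->
      Y *m Z = 0 -> Z *m Y = 0 -> X = Y + Z -> Y = 0 \/ Z = 0].

Definition idempotent_basis A E : Prop :=
  [/\ E ord0 = const_mx n%:R^-1,
      forall l, primitive_idempotent (scheme_span A) (E l) &
      basis_of (scheme_span A) [seq E l | l : 'I_d.+1]].

Definition first_eigenmatrix A E (P : 'M[R]_d.+1) : Prop :=
  forall i, A i = \sum_l P l i *: E l.

End Idempotents.

(* Main.v *)
Require Import Defs.
From HB Require Import structures.
From mathcomp Require Import all_boot all_order all_algebra.
From mathcomp Require Import ring lra.
From mathcomp Require Import all_classical all_reals all_analysis.
From mathcomp Require Import measurable_realfun.
Import Order.TTheory GRing.Theory Num.Theory.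
Import numFieldNormedType.Exports.
Local Open Scope ring_scope.

(* For a sign vector x, qp_obj x = |V|/2 (k1 + k2) + x^T (A2 - A1) x / 2, and
   A2 - A1 = sum_l (P_l2 - P_l1) E_l has largest eigenvalue
   lam = max_l (P_l2 - P_l1); this gives the upper bound.

   For the lower bound let l attain the maximum.  Every matrix of the scheme
   algebra has constant diagonal, so X = E_l / (E_l)_aa is a Gram matrix of unit
   vectors u_a, and the objective with X_ab in place of x_a x_b equals
   |V|/2 (k1 + k2 + lam).  Rounding u_a to the sign of <g, u_a> with g Gaussian
   separates a and b with probability arccos(X_ab) / pi, which loses at most the
   factor alpha_GW on each edge.

   The Gaussian vector g is never constructed: its coordinates are integrated out
   one at a time, and each pair (a, b) only sees functions on R^2, averaged
   successively along the directions (u_a(k), u_b(k)).  Two such averages can be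
   rotated into each other, so the result depends only on the Gram matrix of
   (u_a, u_b), and the separation probability becomes a function of the angle
   alone; it is additive and therefore linear. *)

(** * Affine change of variables for Lebesgue measure on the line *)

Section AffineSubstitution.
Local Open Scope classical_set_scope.
Context {R : realType}.
Notation mu := (@lebesgue_measure R).
Variables a b : R.

Definition affine (x : R) : R := a * x + b.

Lemma measurable_affine :
  measurable_fun [set: measurableTypeR R] (affine : _ -> measurableTypeR R).
Proof. by apply: measurable_funD => //; apply: measurable_funM. Qed.

(** Lebesgue measure is the only measure giving half-open intervals their length, so it suffices to
    compare lengths of preimages of intervals []x, y]]. *)
Lemma lebesgue_measure_affine (A : set (measurableTypeR R)) : a != 0 ->
  measurable A ->
  (mu A = `|a|%:E * pushforward mu (affine : _ -> measurableTypeR R) A)%E.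
Proof.
move=> a0 mA.
pose m : {measure set (measurableTypeR R) -> \bar R} :=
  measure_function_pushforward__canonical__measure_function_Measure
    mu measurable_affine.
pose nu := mscale (NngNum (normr_ge0 a)) m.
rewrite -[RHS]/(nu A).
apply: lebesgue_measure_unique mA => _ [[x y] _ <-] /=.
rewrite /nu/= /mscale/= /pushforward/=.
have [a_gt0|a_lt0|a_eq0] := ltgtP 0 a; last by rewrite -a_eq0 eqxx in a0.
- rewrite (_ : affine @^-1` _ = `](x - b) / a, (y - b) / a]%classic); last first.
    apply/seteqP; split => t /=; rewrite !in_itv/= /affine;
      by rewrite ltr_pdivrMr ?ler_pdivlMr//; lra.
  rewrite !lebesgue_measure_itv/= !lte_fin ltr_pM2r ?invr_gt0// ltrD2r.
  case: ifPn => _; last by rewrite mule0.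
  rewrite -!EFinD -EFinM gtr0_norm//; congr EFin; field; lra.
(* For [a < 0] the preimage is reversed and becomes closed on the left instead of the right. *)
- rewrite (_ : affine @^-1` _ = `[(y - b) / a, (x - b) / a[%classic); last first.
    apply/seteqP; split => t /=; rewrite !in_itv/= /affine;
      by rewrite ltr_ndivlMr ?ler_ndivrMr//; lra.
  rewrite !lebesgue_measure_itv/= !lte_fin ltr_nM2r ?invr_lt0// ltrD2r.
  case: ifPn => _; last by rewrite mule0.
  rewrite -!EFinD -EFinM ltr0_norm//; congr EFin; field; lra.
Qed.

Lemma ge0_integral_affine (f : R -> \bar R) : a != 0 ->
  measurable_fun [set: R] f -> (forall x, 0 <= f x)%E ->
  (\int[mu]_x f x = `|a|%:E * \int[mu]_x f (a * x + b)%R)%E.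
Proof.
move=> a0 mf f0.
pose m : {measure set (measurableTypeR R) -> \bar R} :=
  measure_function_pushforward__canonical__measure_function_Measure
    mu measurable_affine.
transitivity (\int[mscale (NngNum (normr_ge0 a)) m]_x f x)%E.
  apply: eq_measure_integral => A mA _.
  by rewrite /= /mscale/= -lebesgue_measure_affine.
rewrite ge0_integral_mscale//=; congr *%E.
by rewrite ge0_integral_pushforward//; exact: measurable_affine.
Qed.
End AffineSubstitution.

(** * Gaussian averages of functions on the plane along given directions *)

Definition gauss {R : realType} (x : R) : R := normal_pdf 0 1 x.

(* Locked: unification would otherwise unfold nested integrals. *)
HB.lock Definition gavg {R : realType} (h : R * R -> \bar R) (p a : R * R) : \bar R :=
  (\int[@lebesgue_measure R]_z
     (h (a.1 + z * p.1, a.2 + z * p.2)%R * (gauss z)%:E))%E.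
Canonical locked_gavg := Unlockable gavg.unlock.

Section GaussianAverage.
Local Open Scope classical_set_scope.
Context {R : realType}.
Notation mu := (@lebesgue_measure R).
Implicit Types (h : R * R -> \bar R) (p q a : R * R).

Lemma gauss_ge0 (x : R) : 0 <= gauss x.
Proof. exact: normal_pdf_ge0. Qed.

Lemma measurable_gauss : measurable_fun [set: R] (@gauss R).
Proof. exact: measurable_normal_pdf. Qed.

(** The density of two independent standard Gaussians depends only on the distance to the origin. *)
Lemma gaussM_rot (x y x' y' : R) : x ^+ 2 + y ^+ 2 = x' ^+ 2 + y' ^+ 2 ->
  gauss x * gauss y = gauss x' * gauss y' :> R.
Proof.
move=> xy; rewrite /gauss /normal_pdf oner_eq0 /normal_fun.
rewrite !subr0 mulrACA [RHS]mulrACA -!expRD; congr (_ * expR _).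
by rewrite -!mulrDl -!opprD xy.
Qed.

Lemma gavgE h p a : gavg h p a =
  (\int[mu]_z (h (a.1 + z * p.1, a.2 + z * p.2)%R * (gauss z)%:E))%E.
Proof. by rewrite unlock. Qed.

Lemma gavg_ge0 h p a : (forall x, 0 <= h x)%E -> (0 <= gavg h p a)%E.
Proof.
by move=> h0; rewrite gavgE integral_ge0// => z _; rewrite mule_ge0// lee_fin gauss_ge0.
Qed.

Lemma measurable_gauss_integrand d (T : measurableType d) h (f g z : T -> R) :
  measurable_fun setT h -> measurable_fun setT f -> measurable_fun setT g ->
  measurable_fun setT z ->
  measurable_fun setT (fun x => h (f x, g x) * (gauss (z x))%:E)%E.
Proof.
move=> mh mf mg mz; apply: emeasurable_funM.
  by apply: measurableT_comp => //; apply: measurable_fun_pair.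
apply/measurable_EFinP; apply: measurableT_comp => //; exact: measurable_gauss.
Qed.

Lemma measurable_gavg h p : measurable_fun setT h -> (forall x, 0 <= h x)%E ->
  measurable_fun setT (gavg h p).
Proof.
move=> mh h0.
rewrite (_ : gavg h p = fun a => \int[mu]_z
    (h (a.1 + z * p.1, a.2 + z * p.2)%R * (gauss z)%:E))%E; last first.
  by apply/funext => a; rewrite gavgE.
pose F (x : (R * R) * R) :=
  (h (x.1.1 + x.2 * p.1, x.1.2 + x.2 * p.2)%R * (gauss x.2)%:E)%E.
apply: (@measurable_fun_fubini_tonelli_F _ _ _ _ R mu F).
  apply: measurable_gauss_integrand => //; apply: measurable_funD;
    by [apply: measurable_funM|apply: measurableT_comp].
by move=> x; rewrite mule_ge0// lee_fin gauss_ge0.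
Qed.

Lemma gavg_cst (c : \bar R) p a : (0 <= c)%E -> gavg (fun=> c) p a = c.
Proof.
move=> c0; rewrite !gavgE ge0_integralZl//.
- by rewrite integral_normal_pdf mule1.
- by apply/measurable_EFinP; exact: measurable_gauss.
- by move=> x _; rewrite lee_fin gauss_ge0.
Qed.

Lemma measurable_gavg_integrand h p a : measurable_fun setT h ->
  measurable_fun setT
    (fun z : R => h (a.1 + z * p.1, a.2 + z * p.2)%R * (gauss z)%:E)%E.
Proof.
move=> mh; apply: measurable_gauss_integrand => //.
  by apply: measurable_funD => //; apply: measurable_funM.
by apply: measurable_funD => //; apply: measurable_funM.
Qed.

Lemma gavg_le h h' p a : measurable_fun setT h -> measurable_fun setT h' ->
  (forall x, 0 <= h x)%E -> (forall x, h x <= h' x)%E ->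
  (gavg h p a <= gavg h' p a)%E.
Proof.
move=> mh mh' h0 hh'; rewrite !gavgE; apply: ge0_le_integral => //.
- by move=> z _; rewrite mule_ge0// lee_fin gauss_ge0.
- exact: measurable_gavg_integrand.
- exact: measurable_gavg_integrand.
- by move=> z _; rewrite lee_wpmul2r// lee_fin gauss_ge0.
Qed.

Lemma gavgD h h' p a : measurable_fun setT h -> measurable_fun setT h' ->
  (forall x, 0 <= h x)%E -> (forall x, 0 <= h' x)%E ->
  (gavg (h \+ h') p a = gavg h p a + gavg h' p a)%E.
Proof.
move=> mh mh' h0 h'0; rewrite !gavgE -ge0_integralD//.
- by apply: eq_integral => z _; rewrite ge0_muleDl.
- by move=> z _; rewrite mule_ge0// lee_fin gauss_ge0.
- exact: measurable_gavg_integrand.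
- by move=> z _; rewrite mule_ge0// lee_fin gauss_ge0.
- exact: measurable_gavg_integrand.
Qed.

Lemma gavg_gavg h p q a : (forall x, 0 <= h x)%E -> measurable_fun setT h ->
  gavg (gavg h p) q a = (\int[mu]_z \int[mu]_w
    (h (a.1 + z * q.1 + w * p.1, a.2 + z * q.2 + w * p.2)%R *
     (gauss z * gauss w)%:E))%E.
Proof.
move=> h0 mh; rewrite gavgE; apply: eq_integral => z _.
rewrite muleC gavgE -ge0_integralZl//=.
- by apply: eq_integral => w _; rewrite muleCA -EFinM.
- exact: (measurable_gavg_integrand h p (a.1 + z * q.1, a.2 + z * q.2)).
- by move=> w _; rewrite mule_ge0// lee_fin gauss_ge0.
- by rewrite lee_fin gauss_ge0.
Qed.

Lemma measurable_gauss2_integrand h (f g : R * R -> R) :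
  measurable_fun setT h -> measurable_fun setT f -> measurable_fun setT g ->
  measurable_fun setT (fun x => h (f x, g x) * (gauss x.1 * gauss x.2)%:E)%E.
Proof.
move=> mh mf mg; apply: emeasurable_funM.
  by apply: measurableT_comp => //; apply: measurable_fun_pair.
apply/measurable_EFinP; apply: measurable_funM; apply: measurableT_comp => //;
 [exact: measurable_gauss|exact: measurable_gauss].
Qed.

(** Tonelli: independent Gaussian coordinates can be integrated out in either order. *)
Lemma gavgC h p q a : (forall x, 0 <= h x)%E -> measurable_fun setT h ->
  gavg (gavg h p) q a = gavg (gavg h q) p a.
Proof.
move=> h0 mh.
rewrite (gavg_gavg h p q a h0 mh) (gavg_gavg h q p a h0 mh).
pose F (x : R * R) : \bar R :=
  (h (a.1 + x.1 * q.1 + x.2 * p.1, a.2 + x.1 * q.2 + x.2 * p.2)%R *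
     (gauss x.1 * gauss x.2)%:E)%E.
have F0 x : (0 <= F x)%E by rewrite mule_ge0// lee_fin mulr_ge0// gauss_ge0.
have mF : measurable_fun setT F.
  apply: measurable_gauss2_integrand => //;
    by apply: measurable_funD; [apply: measurable_funD => //|]; apply: measurable_funM.
etransitivity; first exact: (fubini_tonelli (m1 := mu) (m2 := mu) F mF F0).
apply: eq_integral => w _; apply: eq_integral => z _; rewrite /F/=.
by congr (h (_, _) * _%:E)%E; ring.
Qed.

(** Rotation invariance of the planar Gaussian. The rotation is factored into two affine
    substitutions of one variable each, with Tonelli in between; this factorization divides by
    [c]. *)
Lemma gavg_rot h p q a (c s : R) : 0 < c -> c ^+ 2 + s ^+ 2 = 1 ->
  (forall x, 0 <= h x)%E -> measurable_fun setT h ->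
  gavg (gavg h p) q a =
  gavg (gavg h (c * p.1 - s * q.1, c * p.2 - s * q.2))
    (s * p.1 + c * q.1, s * p.2 + c * q.2) a.
Proof.
move=> c0 cs h0 mh; have cN0 : c != 0 by rewrite gt_eqF.
rewrite (gavg_gavg h p q a h0 mh) (gavg_gavg _ _ _ _ h0 mh).
pose G (z w : R) : \bar R :=
  (h (a.1 + z * q.1 + w * p.1, a.2 + z * q.2 + w * p.2)%R *
     (gauss z * gauss w)%:E)%E.
have G0 z w : (0 <= G z w)%E by rewrite mule_ge0// lee_fin mulr_ge0// gauss_ge0.
have mG d (T : measurableType d) (f g : T -> R) : measurable_fun setT f ->
    measurable_fun setT g -> measurable_fun setT (fun x => G (f x) (g x)).
  move=> mf mg; apply: emeasurable_funM.
    apply: measurableT_comp => //; apply: measurable_fun_pair;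
      by apply: measurable_funD; [apply: measurable_funD => //|];
        apply: measurable_funM.
  apply/measurable_EFinP; apply: measurable_funM; apply: measurableT_comp => //;
    exact: measurable_gauss.
transitivity (\int[mu]_z \int[mu]_w G z w)%E; first by [].
(* Substitute w := (w + s z) / c, then z := c z - s w; the Jacobians c^-1 and
   c cancel. *)
transitivity (\int[mu]_z \int[mu]_w (c^-1%:E * G z (c^-1 * w + c^-1 * s * z)%R))%E.
  apply: eq_integral => z _.
  rewrite (ge0_integral_affine c^-1 (c^-1 * s * z) (G z)) ?invr_eq0//; last first.
    by apply: mG.
  rewrite -ge0_integralZl//; last first.
    by apply: mG => //; apply: measurable_funD => //; apply: measurable_funM.
  by rewrite gtr0_norm ?invr_gt0.
pose F (x : R * R) : \bar R := (c^-1%:E * G x.1 (c^-1 * x.2 + c^-1 * s * x.1)%R)%E.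
have F0 x : (0 <= F x)%E by rewrite mule_ge0// lee_fin invr_ge0 ltW.
have mF : measurable_fun setT F.
  apply: emeasurable_funM => //; apply: mG => //.
  by apply: measurable_funD; apply: measurable_funM.
etransitivity; first exact: (fubini_tonelli (m1 := mu) (m2 := mu) F mF F0).
transitivity (\int[mu]_w \int[mu]_z G (c * z - s * w)%R (s * z + c * w)%R)%E.
  apply: eq_integral => w _; rewrite /F/=.
  rewrite (ge0_integral_affine c (- (s * w))
    (fun z => c^-1%:E * G z (c^-1 * w + c^-1 * s * z)%R)%E) //; first last.
  - by move=> z; rewrite mule_ge0// lee_fin invr_ge0 ltW.
  - apply: emeasurable_funM => //; apply: mG => //.
    by apply: measurable_funD => //; apply: measurable_funM.
  rewrite -ge0_integralZl//; first last.
  - by move=> z _; rewrite mule_ge0// lee_fin invr_ge0 ltW.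
  - apply: emeasurable_funM => //; apply: mG => //.
      by apply: measurable_funD => //; apply: measurable_funM.
    by apply: measurable_funD => //; apply: measurable_funM => //;
      apply: measurable_funD => //; apply: measurable_funM.
  apply: eq_integral => z _; rewrite muleA -EFinM gtr0_norm// divff// mul1e.
  congr (G _ _).
  (* The factor [c ^+ 2 + s ^+ 2], equal to 1 by [cs], brings in the relation between [c] and [s]
     that [field] alone cannot see. *)
  transitivity (c^-1 * ((c ^+ 2 + s ^+ 2) * w - s ^+ 2 * w) + s * z); last by field.
  by rewrite cs; field.
pose F' (x : R * R) : \bar R := G (c * x.1 - s * x.2)%R (s * x.1 + c * x.2)%R.
have mF' : measurable_fun setT F'.
  by apply: mG; [apply: measurable_funB|apply: measurable_funD]; apply: measurable_funM.
etransitivity.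
  exact/esym/(fubini_tonelli (m1 := mu) (m2 := mu) F' mF' (fun x => G0 _ _)).
apply: eq_integral => z _; apply: eq_integral => w _; rewrite /F'/G/=.
rewrite (gaussM_rot (c * z - s * w) (s * z + c * w) z w).
  by congr (h (_, _) * _%:E)%E; ring.
transitivity ((c ^+ 2 + s ^+ 2) * (z ^+ 2 + w ^+ 2)); first ring.
by rewrite cs mul1r.
Qed.

(** The Gaussian density is even: substitute [- z] for [z]. *)
Lemma gavgN h p a : measurable_fun setT h -> (forall x, 0 <= h x)%E ->
  gavg h (- p.1, - p.2) a = gavg h p a.
Proof.
move=> mh h0; rewrite !gavgE.
rewrite (ge0_integral_affine (-1) 0); first last.
- by move=> z; rewrite mule_ge0// lee_fin gauss_ge0.
- exact: (measurable_gavg_integrand h (- p.1, - p.2)).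
- by rewrite oppr_eq0 oner_eq0.
rewrite normrN1 mul1e; apply: eq_integral => z _ /=.
rewrite !mulN1r !addr0 !mulrNN; congr (_ * _%:E)%E.
by rewrite /gauss /normal_pdf oner_eq0 /normal_fun !subr0 sqrrN.
Qed.

Lemma gavg0 h a : (forall x, 0 <= h x)%E -> gavg h (0, 0) a = h a.
Proof.
move=> h0; rewrite -[RHS](gavg_cst (h a) (0, 0) a)//.
by rewrite !gavgE; apply: eq_integral => z _; rewrite /= !mulr0 !addr0; case: a.
Qed.

(** Independent centred Gaussians add up to a Gaussian whose variance is the sum: a rotation turns
    one of the two directions into zero. *)
Lemma gavg_vert h (s s' : R) : measurable_fun setT h -> (forall x, 0 <= h x)%E ->
  gavg (gavg h (0, s)) (0, s') = gavg h (0, Num.sqrt (s ^+ 2 + s' ^+ 2)).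
Proof.
move=> mh h0.
have N0 t : gavg h (0, - t) = gavg h (0, t).
  by apply/funext => a; rewrite -[in RHS]gavgN//= oppr0.
(* By evenness [s'] can be taken nonnegative; the rotation below needs its cosine [s' / r]
   positive. *)
wlog s'0 : s' / 0 <= s'.
  move=> W; have [/W//|/ltW s'0] := leP 0 s'.
  have := W (- s'); rewrite oppr_ge0 sqrrN => /(_ s'0) <-; apply/funext => a.
  have := gavgN (gavg h (0, s)) (0, s') a; rewrite /= oppr0 => -> //.
    exact: measurable_gavg.
  by move=> x; apply: gavg_ge0.
move: s'0; rewrite le_eqVlt => /orP[/eqP <-|s'0].
  rewrite expr0n/= addr0 sqrtr_sqr; apply/funext => a.
  rewrite gavg0; last by move=> x; apply: gavg_ge0.
  by have [//|_] := ger0P s; rewrite N0.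
have r0 : 0 < s ^+ 2 + s' ^+ 2 by rewrite ltr_wpDl ?sqr_ge0// exprn_gt0.
set r := Num.sqrt _; have r_gt0 : 0 < r by rewrite sqrtr_gt0.
have rE : r ^+ 2 = s ^+ 2 + s' ^+ 2 by rewrite sqr_sqrtr// ltW.
apply/funext => a.
(* This angle makes the inner direction [s' / r * s - s / r * s'] vanish. *)
rewrite (gavg_rot _ _ _ _ (s' / r) (s / r)) ?divr_gt0//; last first.
  by rewrite !expr_div_n -mulrDl [s' ^+ 2 + _]addrC -rE divff// expf_neq0// gt_eqF.
rewrite /= !mulr0 subr0 addr0 [X in (0, X)](_ : _ = 0); last by field; rewrite gt_eqF.
rewrite [X in gavg _ (_, X)](_ : _ = r); last first.
  by apply: (mulIf (lt0r_neq0 r_gt0)); rewrite -[RHS]expr2 rE; field; rewrite gt_eqF.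
by congr gavg; apply/funext => b; exact: gavg0.
Qed.

(* A Givens rotation turns the rows p, q into (r, t), (0, s), preserving their
   2 x 2 Gram matrix. *)
Lemma gavg_givens p q : exists r t s, [/\ 0 <= r,
   [/\ r ^+ 2 = p.1 ^+ 2 + q.1 ^+ 2, r * t = p.1 * p.2 + q.1 * q.2 &
    t ^+ 2 + s ^+ 2 = p.2 ^+ 2 + q.2 ^+ 2] &
    forall h, measurable_fun setT h -> (forall x, 0 <= h x)%E ->
      gavg (gavg h p) q = gavg (gavg h (0, s)) (r, t)].
Proof.
have N0 h p' : measurable_fun setT h -> (forall x, 0 <= h x)%E ->
    gavg h (- p'.1, - p'.2) = gavg h p'.
  by move=> mh h0; apply/funext => a; rewrite gavgN.
have G0 h p' : (forall x, 0 <= h x)%E -> forall x, (0 <= gavg h p' x)%E.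
  by move=> h0 x; exact: gavg_ge0.
case: p => p1 p2; case: q => q1 q2 /=.
(* Negating [q] changes neither the average nor the Gram matrix. *)
wlog q10 : q1 q2 / 0 <= q1.
  move=> W; have [/W//|/ltW q10] := leP 0 q1.
  have [|r [t [s [r0 [E1 E2 E3] E]]]] := W (- q1) (- q2); first by rewrite oppr_ge0.
  exists r, t, s; split; first by [].
    by rewrite E1 E2 E3 !sqrrN !mulrNN.
  move=> h mh h0; rewrite -(E h mh h0); apply/esym/(N0 _ (q1, q2)).
    exact: measurable_gavg.
  exact: G0.
(* If [q1 = 0], exchanging the two rows gives the triangular form, up to the sign of [p1]. *)
move: q10; rewrite le_eqVlt => /orP[/eqP <-|q10].
  have sw h : measurable_fun setT h -> (forall x, 0 <= h x)%E ->
      gavg (gavg h (p1, p2)) (0, q2) = gavg (gavg h (0, q2)) (p1, p2).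
    by move=> mh h0; apply/funext => a; exact: gavgC.
  have [p10|/ltW p10] := leP 0 p1.
    by exists p1, p2, q2; split; [|split; ring|].
  exists (- p1), (- p2), q2; split; [by rewrite oppr_ge0|by split; ring|].
  move=> h mh h0; rewrite (sw h mh h0); apply/esym/(N0 _ (p1, p2)).
    exact: measurable_gavg.
  exact: G0.
have rr0 : 0 < p1 ^+ 2 + q1 ^+ 2 by rewrite ltr_wpDl ?sqr_ge0// exprn_gt0.
set r := Num.sqrt (p1 ^+ 2 + q1 ^+ 2); have r_gt0 : 0 < r by rewrite sqrtr_gt0.
have rE : r ^+ 2 = p1 ^+ 2 + q1 ^+ 2 by rewrite sqr_sqrtr// ltW.
have rN0 : r != 0 by rewrite gt_eqF.
exists r, ((p1 * p2 + q1 * q2) / r), ((q1 * p2 - p1 * q2) / r).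
split; first exact: ltW.
  split; [by []|by rewrite mulrC divfK|].
  apply: (mulIf (expf_neq0 2 rN0)); rewrite [in RHS]rE; field.
  by rewrite rN0.
move=> h mh h0; apply/funext => a.
(* The rotation with cosine [q1 / r] and sine [p1 / r] kills the first coordinate of [p]. *)
rewrite (gavg_rot _ _ _ _ (q1 / r) (p1 / r)) ?divr_gt0//; last first.
  by rewrite !expr_div_n -mulrDl addrC -rE divff// expf_neq0.
rewrite /= [X in (X, q1 / r * p2 - _)](_ : _ = 0); last by field.
rewrite [X in gavg _ (X, _)](_ : _ = r); last first.
  by apply: (mulIf rN0); rewrite -[RHS]expr2 rE; field.
by congr (gavg (gavg _ (_, _)) (_, _)); field.
Qed.

(** The k-th element of [ps] holds the k-th coordinates of two vectors u and v, so this is the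
    expectation of [h] at the base point shifted by (<g, u>, <g, v>), g being standard Gaussian. *)
Definition gavgs (ps : seq (R * R)) h : R * R -> \bar R :=
  foldr (fun p h' => gavg h' p) h ps.

Lemma gavgs_ge0 ps h a : (forall x, 0 <= h x)%E -> (0 <= gavgs ps h a)%E.
Proof. by move=> h0; elim: ps a => //= p ps IH a; exact: gavg_ge0. Qed.

Lemma measurable_gavgs ps h : measurable_fun setT h -> (forall x, 0 <= h x)%E ->
  measurable_fun setT (gavgs ps h).
Proof.
move=> mh h0; elim: ps => //= p ps IH; apply: measurable_gavg => // x.
exact: gavgs_ge0.
Qed.

Lemma gavgs_cst (c : \bar R) ps : (0 <= c)%E -> gavgs ps (fun=> c) = fun=> c.
Proof.
by move=> c0; elim: ps => //= p ps ->; apply/funext => a; exact: gavg_cst.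
Qed.

Lemma gavgs_le ps h h' a : measurable_fun setT h -> measurable_fun setT h' ->
  (forall x, 0 <= h x)%E -> (forall x, h x <= h' x)%E ->
  (gavgs ps h a <= gavgs ps h' a)%E.
Proof.
move=> mh mh' h0 hh'; have h'0 x : (0 <= h' x)%E by apply: le_trans (hh' x).
elim: ps a => //= p ps IH a; apply: gavg_le => //; do ?exact: measurable_gavgs.
by move=> x; exact: gavgs_ge0.
Qed.

Lemma gavgsD ps h h' : measurable_fun setT h -> measurable_fun setT h' ->
  (forall x, 0 <= h x)%E -> (forall x, 0 <= h' x)%E ->
  gavgs ps (h \+ h')%E = (gavgs ps h \+ gavgs ps h')%E.
Proof.
move=> mh mh' h0 h'0; elim: ps => //= p ps ->; apply/funext => a /=.
by apply: gavgD; do ?exact: measurable_gavgs; move=> x; exact: gavgs_ge0.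
Qed.

(** Induction on [ps]: a Givens rotation merges the new row with [(r, t)], and the two vertical rows
    that remain are merged by [gavg_vert]. The result is the Cholesky form of the Gram matrix. *)
Lemma gavgs_reduce ps : exists r t s, [/\ 0 <= r, 0 <= s,
   [/\ r ^+ 2 = \sum_(p <- ps) p.1 ^+ 2, r * t = \sum_(p <- ps) p.1 * p.2 &
    t ^+ 2 + s ^+ 2 = \sum_(p <- ps) p.2 ^+ 2] &
    forall h, measurable_fun setT h -> (forall x, 0 <= h x)%E ->
      gavgs ps h = gavgs [:: (r, t); (0, s)] h].
Proof.
elim: ps => [|p ps [r [t [s [r0 s0 [E1 E2 E3] E]]]]].
  exists 0, 0, 0; rewrite !big_nil; split => //; first by split; ring.
  move=> h mh h0; apply/funext => a /=; rewrite !gavg0// => x; exact: gavg_ge0.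
have [r' [t' [s' [r'0 [E1' E2' E3'] E']]]] := gavg_givens (r, t) p.
exists r', t', (Num.sqrt (s ^+ 2 + s' ^+ 2)); rewrite !big_cons.
split; [by []|exact: sqrtr_ge0| |].
  rewrite sqr_sqrtr ?addr_ge0 ?sqr_ge0// -E1 -E2 -E3; split.
  - by rewrite E1'/= addrC.
  - by rewrite E2'/= addrC.
  - by rewrite [s ^+ 2 + _]addrC addrA E3'/=; ring.
move=> h mh h0 /=; rewrite E//= E'.
- by rewrite gavg_vert.
- exact: measurable_gavg.
- by move=> x; exact: gavg_ge0.
Qed.

(** The Gram matrix determines the reduced form: [r = 1] and [t = cos theta], while [s] and
    [sin theta] are nonnegative with equal squares. *)
Lemma gavgs_angle ps (theta : R) : 0 <= theta <= pi ->
  \sum_(p <- ps) p.1 ^+ 2 = 1 -> \sum_(p <- ps) p.1 * p.2 = cos theta ->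
  \sum_(p <- ps) p.2 ^+ 2 = 1 ->
  forall h, measurable_fun setT h -> (forall x, 0 <= h x)%E ->
    gavgs ps h = gavgs [:: (1, cos theta); (0, sin theta)] h.
Proof.
move=> th0 S1 S2 S3; have [r [t [s [r0 s0 [E1 E2 E3] E]]]] := gavgs_reduce ps.
have r1 : r = 1.
  by apply/eqP; rewrite -sqrp_eq1// E1 S1.
move: E2; rewrite r1 mul1r S2 => tE.
have sE : s = sin theta.
  apply/eqP; rewrite -(@eqrXn2 _ 2)//; last exact: sin_ge0_pi.
  by rewrite sin2cos2 -S3 -E3 tE addrAC subrr add0r.
by move=> h mh h0; rewrite E// r1 tE sE.
Qed.
End GaussianAverage.

(** * The probability that a Gaussian functional has different signs at two vectors *)

Section HyperplaneRounding.
Local Open Scope classical_set_scope.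
Context {R : realType}.
Notation mu := (@lebesgue_measure R).

Definition sign_diff (x : R * R) : \bar R := ((0 <= x.1) != (0 <= x.2))%:R%:E.
Definition sign_eq (x : R * R) : \bar R := ((0 <= x.1) == (0 <= x.2))%:R%:E.

Lemma sign_diff_ge0 x : (0 <= sign_diff x)%E. Proof. by rewrite lee_fin. Qed.

Lemma sign_eq_ge0 x : (0 <= sign_eq x)%E. Proof. by rewrite lee_fin. Qed.

Lemma measurable_sign_diff : measurable_fun setT sign_diff.
Proof.
rewrite (_ : sign_diff = fun x => if (0 <= x.1)%R then
    (if (0 <= x.2)%R then 0%E else 1%E) else (if (0 <= x.2)%R then 1%E else 0%E)).
  by apply: measurable_fun_ifT => //; try apply: measurable_fun_ifT => //;
    apply: measurable_fun_ler.
by apply/funext => x; rewrite /sign_diff; do 2 case: ifP.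
Qed.

Lemma measurable_sign_eq : measurable_fun setT sign_eq.
Proof.
rewrite (_ : sign_eq = fun x => if (0 <= x.1)%R then
    (if (0 <= x.2)%R then 1%E else 0%E) else (if (0 <= x.2)%R then 0%E else 1%E)).
  by apply: measurable_fun_ifT => //; try apply: measurable_fun_ifT => //;
    apply: measurable_fun_ler.
by apply/funext => x; rewrite /sign_eq; do 2 case: ifP.
Qed.

Lemma sign_diff_eq : (sign_diff \+ sign_eq)%E = fun=> 1%E.
Proof.
apply/funext => x; rewrite /sign_diff /sign_eq /= -EFinD -natrD.
by case: (_ == _).
Qed.

Lemma sign_diff_le1 x : (sign_diff x <= 1)%E.
Proof. by rewrite lee_fin lern1 leq_b1. Qed.

(* Each b in bs is one coordinate of the vectors indexed by T, and x is an offset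
   added to all of them, as needed for the induction. *)
Lemma gavgs_bound (T : Type) (I : finType) (w : I -> R) (h : I -> R * R -> \bar R)
    (u v : I -> T) (M : \bar R) :
  (forall i, 0 <= w i) -> (forall i, measurable_fun setT (h i)) ->
  (forall i x, 0 <= h i x)%E ->
  (forall x : T -> R, (\sum_i (w i)%:E * h i (x (u i), x (v i)) <= M)%E) ->
  forall (bs : seq (T -> R)) (x : T -> R),
  (\sum_i (w i)%:E *
     gavgs [seq (b (u i), b (v i)) | b <- bs] (h i) (x (u i), x (v i)) <= M)%E.
Proof.
move=> w0 mh h0 hM; elim=> [|b bs IH] x; first exact: hM.
have M0 : (0 <= M)%E.
  by apply: le_trans (hM x); apply: sume_ge0 => i _; rewrite mule_ge0// lee_fin.
(* [M] is its own average, so both sides become integrals over the new coordinate [z], and the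
   induction hypothesis applies pointwise with offset [x t + z * b t]. *)
rewrite -[leRHS](@gavg_cst R M (0, 0) (0, 0))// gavgE /=.
set H := fun i => gavgs [seq (c (u i), c (v i)) | c <- bs] (h i).
have H0 i y : (0 <= H i y)%E by exact: gavgs_ge0.
have mH i : measurable_fun setT (H i) by exact: measurable_gavgs.
pose f i (z : R) := ((w i)%:E *
  (H i (x (u i) + z * b (u i), x (v i) + z * b (v i))%R * (gauss z)%:E))%E.
have f0 i z : (0 <= f i z)%E by rewrite !mule_ge0// lee_fin// gauss_ge0.
have ml i : measurable_fun setT (fun z : R =>
    H i (x (u i) + z * b (u i), x (v i) + z * b (v i))%R * (gauss z)%:E)%E.
  exact: (measurable_gavg_integrand (H i) (b (u i), b (v i)) (x (u i), x (v i))).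
have mf i : measurable_fun setT (f i) by apply: emeasurable_funM.
rewrite (_ : (\sum_i _)%E = \int[mu]_z \sum_i f i z)%E; last first.
  rewrite ge0_integral_sum//; apply: eq_bigr => i _.
  by rewrite gavgE /f ge0_integralZl//;
    [exact: ml|move=> z _; rewrite mule_ge0// lee_fin gauss_ge0|rewrite lee_fin].
apply: ge0_le_integral => //.
- by move=> z _; apply: sume_ge0.
- by apply: emeasurable_sum.
- by apply: emeasurable_funM => //; apply/measurable_EFinP; exact: measurable_gauss.
move=> z _; rewrite (_ : (\sum_i _)%E = (\sum_i (w i)%:E *
    H i (x (u i) + z * b (u i), x (v i) + z * b (v i))%R) * (gauss z)%:E)%E.
  rewrite lee_wpmul2r// ?lee_fin ?gauss_ge0//.
  exact: (IH (fun t => x t + z * b t)).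
rewrite ge0_sume_distrl; last by move=> i _; rewrite mule_ge0// lee_fin.
by apply: eq_bigr => i _; rewrite /f muleA.
Qed.

(** Expresses the average through one standard Gaussian point [x] of the plane, so that events for
    different pairs of directions can be compared pointwise. *)
Lemma gavgs_linear (h : R * R -> \bar R) (u1 u2 v1 v2 : R) :
  gavgs [:: (u1, v1); (u2, v2)] h (0, 0) =
  gavgs [:: (1, 0); (0, 1)]
    (fun x => h (u1 * x.1 + u2 * x.2, v1 * x.1 + v2 * x.2)) (0, 0).
Proof.
rewrite /= [LHS]gavgE [RHS]gavgE; apply: eq_integral => z _; congr (_ * _)%E.
rewrite !gavgE; apply: eq_integral => w _; congr (h (_, _) * _)%E => /=; ring.
Qed.

(** The probability that the signs of <g, u> and <g, v> differ, for unit vectors u, v at angle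
    [theta]. *)
Definition crossing (theta : R) : \bar R :=
  gavgs [:: (1, cos theta); (0, sin theta)] sign_diff (0, 0).

Let ray (alpha : R) (x : R * R) : R := cos alpha * x.1 + sin alpha * x.2.

Let diff_rays (alpha beta : R) (x : R * R) : \bar R :=
  sign_diff (ray alpha x, ray beta x).

Let measurable_rays alpha beta : measurable_fun setT (diff_rays alpha beta).
Proof.
apply: measurableT_comp; first exact: measurable_sign_diff.
by apply: measurable_fun_pair; apply: measurable_funD; apply: measurable_funM.
Qed.

Let diff_rays_ge0 alpha beta x : (0 <= diff_rays alpha beta x)%E.
Proof. exact: sign_diff_ge0. Qed.

(** Only the angle matters, as the unit vectors at angles [alpha] and [beta] have inner product
    [cos (beta - alpha)]. *)
Let crossing_rays alpha beta : 0 <= beta - alpha <= pi ->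
  gavgs [:: (1, 0); (0, 1)] (diff_rays alpha beta) (0, 0) =
  crossing (beta - alpha).
Proof.
move=> ab; rewrite -(gavgs_linear sign_diff) (@gavgs_angle _ _ (beta - alpha))//;
  rewrite ?big_cons ?big_nil/= ?addr0 ?cos2Dsin2//.
- by rewrite cosB; ring.
- exact: measurable_sign_diff.
- exact: sign_diff_ge0.
Qed.

(** The middle ray is a nonnegative combination of the outer two, so it takes any sign they share.
    Hence the outer signs differ exactly when one of the two consecutive pairs differs, and never do
    both. *)
Lemma crossing_add (beta gamma : R) : 0 <= beta <= gamma -> 0 < gamma < pi ->
  (crossing gamma = crossing beta + crossing (gamma - beta)%R)%E.
Proof.
move=> bg g0.
have := crossing_rays 0 gamma; have := crossing_rays 0 beta.
rewrite !subr0 => <-; last lra.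
move=> <-; last lra.
rewrite -crossing_rays; last lra.
have D := @gavgsD R [:: (1, 0); (0, 1)] (diff_rays 0 beta)
  (diff_rays beta gamma) (measurable_rays _ _) (measurable_rays _ _)
  (diff_rays_ge0 _ _) (diff_rays_ge0 _ _).
transitivity (gavgs [:: (1, 0); (0, 1)]
  (diff_rays 0 beta \+ diff_rays beta gamma)%E (0, 0)); last by rewrite D.
congr (gavgs _ _ (0, 0)).
apply/funext => x; rewrite /diff_rays /sign_diff /=.
have sg : 0 < sin gamma by apply: sin_gt0_pi; lra.
have sb : 0 <= sin beta by apply: sin_ge0_pi; lra.
have sgb : 0 <= sin (gamma - beta) by apply: sin_ge0_pi; lra.
have E : sin gamma * ray beta x = sin (gamma - beta) * ray 0 x + sin beta * ray gamma x.
  by rewrite /ray sinB cos0 sin0; ring.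
(* One strictly positive coefficient is needed because zero counts as a nonnegative sign: two
   negative values must give a strictly negative one. *)
have sbb : 0 < sin beta \/ 0 < sin (gamma - beta).
  have [b0|b0] := ltP 0 beta; first by left; apply: sin_gt0_pi; lra.
  by right; apply: sin_gt0_pi; lra.
move: sg sb sgb E sbb; move: (sin gamma) (sin beta) (sin (gamma - beta)).
move: (ray 0 x) (ray gamma x) (ray beta x) => r0 rg rb sg sb sgb {}sg0 sb0 sgb0 E sbb.
have rb_ge0 : 0 <= r0 -> 0 <= rg -> 0 <= rb.
  by move=> r00 rg0; rewrite -(pmulr_rge0 _ sg0) E addr_ge0// mulr_ge0.
have rb_lt0 : r0 < 0 -> rg < 0 -> rb < 0.
  move=> r00 rg0; rewrite -(pmulr_rlt0 _ sg0) E.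
  by case: sbb => ?; [rewrite ltr_wnDl|rewrite ltr_wnDr];
    rewrite ?mulr_ge0_le0 ?pmulr_rlt0// ltW.
have [r0_ge0|r0_lt0] := leP 0 r0; have [rg_ge0|rg_lt0] := leP 0 rg.
- by rewrite rb_ge0//= addr0.
- by case: (0 <= rb); rewrite /= ?addr0 ?add0r.
- by case: (0 <= rb); rewrite /= ?addr0 ?add0r.
- by rewrite [0 <= rb]leNgt rb_lt0//= addr0.
Qed.

Lemma crossing_ge0 theta : (0 <= crossing theta)%E.
Proof. by apply: gavgs_ge0; exact: sign_diff_ge0. Qed.

Lemma crossing_le1 theta : (crossing theta <= 1)%E.
Proof.
have := @gavgs_le R [:: (1, cos theta); (0, sin theta)] sign_diff (fun=> 1%E) (0, 0).
rewrite gavgs_cst//; apply => //; [exact: measurable_sign_diff|exact: sign_diff_ge0|].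
exact: sign_diff_le1.
Qed.

Lemma crossing_fin theta : crossing theta \is a fin_num.
Proof.
rewrite ge0_fin_numE ?crossing_ge0//.
by apply: le_lt_trans (crossing_le1 theta) _; rewrite ltry.
Qed.

Lemma crossing_pi : crossing pi = 1%E.
Proof.
rewrite /crossing cospi sinpi /= (_ : gavg sign_diff (0, 0) = sign_diff); last first.
  by apply/funext => a; apply: gavg0; exact: sign_diff_ge0.
rewrite gavgE /= -[RHS](@integral_normal_pdf R 0 1).
(* At [z = 0] both coordinates count as nonnegative, so this null point is removed from both
   integrals. *)
have mD : measurable ([set: R] `\ 0) by apply: measurableD.
have D0 (f : R -> \bar R) : measurable_fun [set: R] f ->
    (\int[mu]_(z in ([set: R] `\ 0)%R) f z = \int[mu]_z f z)%E.
  by move=> mf; rewrite integral_setD1//; exact: measurable_funTS.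
rewrite -[LHS]D0; last first.
  exact: (measurable_gavg_integrand sign_diff (1, -1) (0, 0) measurable_sign_diff).
rewrite -[RHS]D0; last by apply/measurable_EFinP; exact: measurable_gauss.
apply: eq_integral => z; rewrite inE => -[_ /= z0].
rewrite !add0r mulr1 mulrN1 /sign_diff /= oppr_ge0.
have -> : ((0 <= z) != (z <= 0)) = true by move/eqP: z0; case: ltgtP.
by rewrite mul1e.
Qed.

(** At angle [pi] the outer rays are opposite and the combination argument degenerates; the triangle
    inequality for sign changes still holds pointwise. *)
Lemma crossing_subadd_pi (beta : R) : 0 <= beta <= pi ->
  (1 <= crossing beta + crossing (pi - beta)%R)%E.
Proof.
move=> bg; rewrite -crossing_pi.
have := crossing_rays 0 pi; have := crossing_rays 0 beta.
rewrite !subr0 => <-; last lra.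
move=> <-; last lra.
rewrite -crossing_rays; last lra.
have D := @gavgsD R [:: (1, 0); (0, 1)] (diff_rays 0 beta)
  (diff_rays beta pi) (measurable_rays _ _) (measurable_rays _ _)
  (diff_rays_ge0 _ _) (diff_rays_ge0 _ _).
apply: (@le_trans _ _ (gavgs [:: (1, 0); (0, 1)]
  (diff_rays 0 beta \+ diff_rays beta pi)%E (0, 0))); last by rewrite D.
apply: gavgs_le => //.
  exact: emeasurable_funD.
move=> x; rewrite /diff_rays /sign_diff /= -EFinD lee_fin.
by rewrite -natrD ler_nat; do 3 case: (0 <= _).
Qed.

Let c (theta : R) : R := fine (crossing theta).

Let cE theta : (c theta)%:E = crossing theta.
Proof. by rewrite fineK// crossing_fin. Qed.

Let c_ge0 theta : 0 <= c theta. Proof. by rewrite fine_ge0// crossing_ge0. Qed.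

Let c_le1 theta : c theta <= 1.
Proof. by rewrite -lee_fin cE crossing_le1. Qed.

Let cM n x : 0 < x -> n.+1%:R * x < pi -> c (n.+1%:R * x) = n.+1%:R * c x.
Proof.
move=> x0; elim: n => [|n IH] npi; first by rewrite !mul1r.
have n0 : 0 <= n%:R :> R by rewrite ler0n.
have E : (c (n.+2%:R * x) = c x + c (n.+2%:R * x - x))%R.
  apply: EFin_inj; rewrite EFinD !cE; apply: crossing_add;
    rewrite -!natr1 in npi *; nra.
rewrite E (_ : n.+2%:R * x - x = n.+1%:R * x); last by rewrite -[n.+2%:R]natr1; ring.
rewrite IH; last by rewrite -!natr1 in npi *; nra.
by rewrite -[n.+2%:R]natr1; ring.
Qed.

(* c x = m c (x / m) <= m / N whenever N x / m < pi; take N close to m pi / x and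
   let m grow. *)
Let c_le x : 0 < x < pi -> c x <= x / pi.
Proof.
move=> /andP[x0 xpi]; have pi0 : 0 < pi :> R by exact: pi_gt0.
have nc n y : 0 < y -> n%:R * y < pi -> n%:R * c y <= 1.
  by case: n => [|n] y0 ny; [rewrite mul0r ler01|rewrite -cM// c_le1].
rewrite leNgt; apply/negP => cx.
have d0 : 0 < c x * pi - x by rewrite subr_gt0 -ltr_pdivrMr.
(* Scaled by [m], the gap [c x * pi - x] exceeds the error [2 * (c x * x)] caused by replacing
   [pi / y] with an integer below it. *)
pose m := (Num.truncn (2 * (c x * x) / (c x * pi - x))).+1.
have m_gt : 2 * (c x * x) < m%:R * (c x * pi - x).
  by rewrite -ltr_pdivrMr// truncnS_gt.
have m0 : 0 < m%:R :> R by rewrite ltr0n.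
have [y xE] : exists y, x = m%:R * y by exists (x / m%:R); rewrite mulrC divfK// gt_eqF.
have y0 : 0 < y by rewrite -(pmulr_rgt0 _ m0) -xE.
have cxE : c x = m%:R * c y by rewrite xE cM// -xE.
pose N := Num.truncn (pi / y).
have /andP[N1 N2] : N%:R <= pi / y < N.+1%:R.
  by apply: truncn_itv; rewrite divr_ge0// ltW.
rewrite ler_pdivlMr// in N1; rewrite ltr_pdivrMr// in N2.
(* [N%:R * y] may equal [pi], whereas [nc] asks for a strict inequality; hence [N.-1]. *)
have := nc N.-1 y y0; rewrite -subn1.
have N_gt0 : (0 < N)%N.
  rewrite lt0n; apply/eqP => N0; rewrite N0 in N2.
  have : 1 <= m%:R :> R by rewrite ler1n.
  nra.
rewrite natrB// => /(_ ltac:(lra)) H.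
rewrite -natr1 in N2.
have c0 := c_ge0 y.
have H1 : c y * (pi - 2 * y) <= c y * ((N%:R - 1) * y) by rewrite ler_wpM2l//; lra.
have H2 : (N%:R - 1) * c y * y <= 1 * y by rewrite ler_pM2r.
have : 2 * (c y * y) < c y * pi - y.
  rewrite -(ltr_pM2l (exprn_gt0 2 m0)).
  rewrite (_ : _ * (2 * _) = 2 * (c x * x)); last by rewrite cxE xE; ring.
  rewrite (_ : _ * (_ - y) = m%:R * (c x * pi - x))//.
  by rewrite cxE xE; ring.
lra.
Qed.

(** The upper bound [c_le] at [pi - theta], together with [crossing_subadd_pi], yields the matching
    lower bound at [theta]. *)
Lemma crossingE theta : 0 <= theta <= pi -> crossing theta = (theta / pi)%:E.
Proof.
have pi0 : 0 < pi :> R by exact: pi_gt0.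
move=> /andP[]; rewrite le_eqVlt => /orP[/eqP <- _|t0].
  (* Additivity with [beta = gamma] forces the value at angle 0 to vanish. *)
  have := @crossing_add (pi / 4) (pi / 4) ltac:(lra) ltac:(lra).
  by rewrite subrr -!cE -EFinD mul0r => -[E]; congr EFin; lra.
rewrite le_eqVlt => /orP[/eqP ->|tpi]; first by rewrite crossing_pi divff// gt_eqF.
rewrite -cE; congr EFin; apply/eqP; rewrite eq_le c_le ?t0//=.
have := crossing_subadd_pi theta; rewrite -!cE -EFinD lee_fin => /(_ ltac:(lra)).
have := c_le (pi - theta) ltac:(lra).
by rewrite mulrBl divff ?gt_eqF//; lra.
Qed.
End HyperplaneRounding.

(** * Hyperplane rounding and the Goemans-Williamson ratio *)

Section Rounding.
Context {R : realType}.

(** The guarantee for a pair that counts when separated. Angle 0 lies outside the definition of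
    [alpha_GW], but there both sides vanish. *)
Lemma alpha_GW_le (theta : R) : 0 <= theta <= pi ->
  alpha_GW R / 2 * (1 - cos theta) <= theta / pi.
Proof.
move=> /andP[]; rewrite le_eqVlt => /orP[/eqP <- _|t0 tpi].
  by rewrite cos0 subrr mulr0 mul0r.
have cpos : 0 < 1 - cos theta.
  rewrite subr_gt0 -(cos0 R) ltr_cos // in_itv /= ?lexx ?(ltW t0) //=.
  exact: pi_ge0.
have [_ /(_ theta)] := alpha_GW_min R; rewrite t0 tpi => /(_ isT).
rewrite /gw_ratio mulrA ler_pdivlMr// => H.
rewrite mulrAC ler_pdivrMr//; apply: le_trans H _.
by rewrite mulrAC -mulrA mulrC.
Qed.

(** The guarantee for a pair that counts when not separated, obtained from the supplementary
    angle. *)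
Lemma alpha_GW_le_compl (theta : R) : 0 <= theta <= pi ->
  alpha_GW R / 2 * (1 + cos theta) <= 1 - theta / pi.
Proof.
move=> t; have := alpha_GW_le (pi - theta) ltac:(lra).
by rewrite cosB cospi sinpi mul0r addr0 mulN1r opprK mulrBl divff// gt_eqF// pi_gt0.
Qed.

(** Expand the squared norm of the sum and of the difference of two unit columns. *)
Lemma gram_le1 m n (B : 'M[R]_(m, n)) : (forall a, (B^T *m B) a a = 1) ->
  forall a b, -1 <= (B^T *m B) a b <= 1.
Proof.
move=> B1 a b.
have XE c e : (B^T *m B) c e = \sum_k B k c * B k e.
  by rewrite mxE; apply: eq_bigr => k _; rewrite mxE.
have E (s : R) : s ^+ 2 = 1 -> 0 <= 1 + 1 + s * (B^T *m B) a b *+ 2.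
  move=> s1; rewrite -[X in X + 1](B1 a) -[X in _ + X + _](B1 b) !XE.
  rewrite mulr_sumr -sumrMnl -!big_split /=; apply: sumr_ge0 => k _.
  rewrite (_ : _ + _ = (B k a + s * B k b) ^+ 2) ?sqr_ge0//.
  by rewrite sqrrD exprMn s1; ring.
have := E 1 (expr1n _ 2); have := E (-1); rewrite sqrrN expr1n => /(_ erefl).
lra.
Qed.

(* The vectors being rounded are the columns of B, so B^T *m B is their Gram
   matrix. *)
Lemma hyperplane_rounding m n (B : 'M[R]_(m, n)) (w1 w2 : 'M[R]_n) (M : R) :
  (forall a, (B^T *m B) a a = 1) ->
  (forall a b, 0 <= w1 a b) -> (forall a b, 0 <= w2 a b) ->
  (forall x : 'I_n -> R, \sum_a \sum_b
     (w1 a b * ((0 <= x a) != (0 <= x b))%:R +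
      w2 a b * ((0 <= x a) == (0 <= x b))%:R) <= M) ->
  alpha_GW R / 2 * \sum_a \sum_b
    (w1 a b * (1 - (B^T *m B) a b) + w2 a b * (1 + (B^T *m B) a b)) <= M.
Proof.
move=> B1 w1_ge0 w2_ge0 hM.
(* The tag [true] marks terms counting separated pairs, with weight [w1]; [false] marks those
   counting unseparated pairs, with weight [w2]. *)
pose I := (bool * ('I_n * 'I_n))%type.
pose w (i : I) := if i.1 then w1 i.2.1 i.2.2 else w2 i.2.1 i.2.2.
pose h (i : I) : R * R -> \bar R := if i.1 then sign_diff else sign_eq.
have h0 i x : (0 <= h i x)%E.
  by rewrite /h; case: ifP => _; [exact: sign_diff_ge0|exact: sign_eq_ge0].
have sumI (f : I -> R) : \sum_i f i =
    \sum_a \sum_b (f (true, (a, b)) + f (false, (a, b))).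
  rewrite (eq_bigr (fun i => f (i.1, i.2))) => [|[]//].
  rewrite -(pair_bigA _ (fun (i : bool) (p : 'I_n * 'I_n) => f (i, p)))/= big_bool/=.
  rewrite -big_split/=.
  rewrite [RHS](pair_bigA _ (fun a b => f (true, (a, b)) + f (false, (a, b))))/=.
  by apply: eq_bigr => -[].
(* Row [k] of [B] lists the k-th coordinates of all vectors and so carries one Gaussian
   coordinate. *)
pose bs := [seq (fun j => B k j) | k <- enum 'I_m].
have := @gavgs_bound R 'I_n I w h (fun i => i.2.1) (fun i => i.2.2) M%:E
  _ _ h0 _ bs (fun=> 0).
have wh0 i : 0 <= w i by rewrite /w; case: ifP.
have mh i : measurable_fun setT (h i).
  rewrite /h; case: ifP => _.
    exact: measurable_sign_diff.
  exact: measurable_sign_eq.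
move=> /(_ wh0 mh) G.
pose X := B^T *m B.
pose t a b := acos (X a b) / pi.
have X1 a b : -1 <= X a b <= 1 := gram_le1 _ _ _ B1 a b.
have XE c e : X c e = \sum_k B k c * B k e.
  by rewrite mxE; apply: eq_bigr => k _; rewrite mxE.
have sep a b : gavgs [seq (c a, c b) | c <- bs] sign_diff (0, 0) = (t a b)%:E.
  rewrite (@gavgs_angle _ _ (acos (X a b))); first last.
  - exact: sign_diff_ge0.
  - exact: measurable_sign_diff.
  - by rewrite big_map big_map big_enum /= -(B1 b) XE.
  - by rewrite big_map big_map big_enum /= acosK ?in_itv//= XE.
  - by rewrite big_map big_map big_enum /= -(B1 a) XE.
  - by rewrite acos_ge0// acos_lepi.
  by apply: crossingE; rewrite acos_ge0// acos_lepi.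
have tog a b : gavgs [seq (c a, c b) | c <- bs] sign_eq (0, 0) = (1 - t a b)%:E.
  have := @gavgsD R [seq (c a, c b) | c <- bs] sign_diff sign_eq
    measurable_sign_diff measurable_sign_eq sign_diff_ge0 sign_eq_ge0.
  rewrite sign_diff_eq gavgs_cst// => /(congr1 (fun f => f (0, 0))) /=.
  rewrite sep; case: (gavgs _ _ _) => //= r [E].
  by congr EFin; rewrite E addrAC subrr add0r.
(* The bound for every fixed [x] passes to the expectation, where the indicators become the
   probabilities [t] and [1 - t]. *)
have {}G : \sum_i w i * (if i.1 then t i.2.1 i.2.2 else 1 - t i.2.1 i.2.2) <= M.
  rewrite -lee_fin -sumEFin; apply: le_trans (G _).
    by apply: lee_sum => -[[] [a b]] _; rewrite /h /= ?sep ?tog EFinM.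
  move=> x; pose g (i : I) : R := if i.1 then ((0 <= x i.2.1) != (0 <= x i.2.2))%:R
      else ((0 <= x i.2.1) == (0 <= x i.2.2))%:R.
  rewrite (eq_bigr (fun i => (w i * g i)%:E)); last first.
    by move=> -[[] [a b]] _; rewrite EFinM.
  rewrite sumEFin lee_fin sumI; exact: (hM x).
apply: le_trans G; rewrite sumI mulr_sumr; apply: ler_sum => a _.
rewrite mulr_sumr; apply: ler_sum => b _.
have tI : 0 <= acos (X a b) <= pi by rewrite acos_ge0// acos_lepi.
have Xin : X a b \in `[-1, 1] by rewrite in_itv/=.
have := alpha_GW_le _ tI; have := alpha_GW_le_compl _ tI; rewrite (acosK Xin) => L2 L1.
rewrite mulrDr mulrCA [X in _ + X]mulrCA /w /=.
by apply: lerD; apply: ler_wpM2l.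
Qed.
End Rounding.

(** * Sums over edges expressed with adjacency matrices *)

Section GraphSums.
Context {R : realType} {V : finType}.
Implicit Types G : sgraph V.

(** Group the ordered pairs by their underlying set: an edge comes from exactly two pairs, since its
    ends are distinct. *)
Lemma sum_adjmx G (f : {set V} -> R) :
  \sum_a \sum_b adjmx R G a b * f [set enum_val a; enum_val b]%SET =
  2 * \sum_(e in edges G) f e.
Proof.
have -> : \sum_a \sum_b adjmx R G a b * f [set enum_val a; enum_val b]%SET =
    \sum_(u : V) \sum_(v : V) ([set u; v]%SET \in edges G)%:R * f [set u; v]%SET.
  rewrite [RHS]big_enum_val /=; apply: eq_bigr => a _.
  rewrite [RHS]big_enum_val /=; apply: eq_bigr => b _.
  by rewrite mxE.
rewrite pair_bigA /= (bigID (fun p => [set p.1; p.2]%SET \in edges G)) /=.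
rewrite [X in _ + X]big1 ?addr0; last by move=> p /negbTE ->; rewrite mul0r.
rewrite (partition_big (fun p => [set p.1; p.2]%SET) (mem (edges G))) //= mulr_sumr.
apply: eq_bigr => e eG.
have /cards2P[u [v [uv eE]]] : #|e| == 2%N by rewrite (card_edge eG).
rewrite (eq_bigr (fun=> f e)); last by move=> p /andP[-> /eqP ->]; rewrite mul1r.
rewrite sumr_const mulr_natl; congr (_ *+ _).
have <- : #|[set (u, v); (v, u)]%SET| = 2%N by rewrite cards2 xpair_eqE negb_and uv.
apply: eq_card => -[a b]; rewrite !inE unfold_in /= !xpair_eqE.
apply/andP/orP => [[_ /eqP abe]|].
  have va : v \in [set a; b]%SET by rewrite abe eE set22.
  have ua : u \in [set a; b]%SET by rewrite abe eE set21.
  have /set2P[aE|aE] : a \in [set u; v]%SET by rewrite -eE -abe set21.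
    left; rewrite aE eqxx /=; move: va.
    by rewrite aE !inE [v == u]eq_sym (negbTE uv) eq_sym.
  right; rewrite aE eqxx /=; move: ua.
  by rewrite aE !inE (negbTE uv) eq_sym.
move=> H; have abe : [set a; b]%SET = e.
  by case: H => /andP[/eqP -> /eqP ->]; rewrite eE// finset.setUC.
by rewrite abe eqxx.
Qed.

Lemma qp_obj_adjmx G1 G2 (x : V -> R) : 2 * qp_obj G1 G2 x =
  \sum_a \sum_b (adjmx R G1 a b * (1 - x (enum_val a) * x (enum_val b)) +
                 adjmx R G2 a b * (1 + x (enum_val a) * x (enum_val b))).
Proof.
rewrite /qp_obj mulrDr -!sum_adjmx -big_split/=; apply: eq_bigr => a _.
rewrite -big_split/=; apply: eq_bigr => b _.
have prodE G : [set enum_val a; enum_val b]%SET \in edges G ->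
    \prod_(i in [set enum_val a; enum_val b]%SET) x i = x (enum_val a) * x (enum_val b).
  move=> /card_edge; rewrite cards2; case: eqVneq => // ab _.
  by rewrite big_setU1 ?inE//= big_set1.
by congr (_ + _); rewrite !mxE; case: (boolP (_ \in _)) => [/prodE ->|];
  rewrite // !mul0r.
Qed.

Lemma regular_row_sum G k a : regular G k -> \sum_b adjmx R G a b = k%:R.
Proof.
move=> /(_ (enum_val a)) <-; rewrite cardE -sum1_size big_enum/= natr_sum.
rewrite [RHS]big_mkcond/= [RHS]big_enum_val/=.
by apply: eq_bigr => b _; rewrite !mxE inE; case: (_ \in _).
Qed.

Lemma adjmx_ge0 G a b : 0 <= adjmx R G a b.
Proof. by rewrite mxE. Qed.
End GraphSums.

(** * The Bose-Mesner algebra and its primitive idempotents *)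

Lemma span_ind (K : fieldType) (vT : vectType K) (X : seq vT) (P : vT -> Prop) :
  P 0 -> (forall c u v, u \in X -> P v -> P (c *: u + v)) ->
  forall v, v \in <<X>>%VS -> P v.
Proof.
move=> P0 PD v /(@coord_span _ _ _ (in_tuple X)) ->.
elim/big_rec: _ => // i u _ Pu; apply: PD => //.
by rewrite mem_nth.
Qed.

Section Scheme.
Context {R : realType} {n d : nat} (A E : 'I_d.+1 -> 'M[R]_n).
Hypothesis hA : assoc_scheme A.
Let U := scheme_span A.

Lemma mem_scheme i : A i \in U.
Proof. by apply: memv_span; exact: fintype.image_f. Qed.

Lemma scheme_ind (P : 'M[R]_n -> Prop) : P 0 ->
  (forall c i X, P X -> P (c *: A i + X)) -> forall X, X \in U -> P X.
Proof.
move=> P0 PD; apply: span_ind => // c u v.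
by move=> /fintype.imageP[i _ ->]; exact: PD.
Qed.

Lemma scheme_span_mul X Y : X \in U -> Y \in U -> X *m Y \in U.
Proof.
move=> + YU; move: X; apply: scheme_ind => [|c i X IH]; first by rewrite mul0mx mem0v.
rewrite mulmxDl -scalemxAl memvD ?memvZ//.
move: Y YU {IH X}; apply: scheme_ind => [|c' j X IH]; first by rewrite mulmx0 mem0v.
rewrite mulmxDr -scalemxAr memvD ?memvZ//.
have [p ->] := scheme_mul hA i j.
by apply: memv_suml => l _; rewrite memvZ// mem_scheme.
Qed.

Lemma scheme_span_sym X : X \in U -> X^T = X.
Proof.
move: X; apply: scheme_ind => [|c i X IH]; first by rewrite trmx0.
by rewrite linearD linearZ/= (scheme_sym hA) IH.
Qed.

(** The product lies in the algebra and so is symmetric, while transposing reverses the factors. *)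
Lemma scheme_span_comm X Y : X \in U -> Y \in U -> X *m Y = Y *m X.
Proof.
move=> XU YU; rewrite -(scheme_span_sym _ (scheme_span_mul _ _ XU YU)).
by rewrite trmx_mul !scheme_span_sym.
Qed.

(** The identity [A ord0] already supplies the diagonal ones of the all-ones matrix, and all entries
    are nonnegative. *)
Lemma scheme_diag0 i a : i != ord0 -> A i a a = 0.
Proof.
move=> i0; have /matrixP/(_ a a) := scheme_sum hA.
rewrite summxE mxE (bigD1 ord0)//= (scheme_id hA) mxE eqxx.
rewrite -[RHS]addr0 => /addrI/eqP.
rewrite psumr_eq0; last first.
  by move=> j _; case/orP: (scheme_01 hA j a a) => /eqP ->.
by move=> /allP/(_ i (mem_index_enum _)); rewrite i0 => /eqP.
Qed.

Lemma scheme_span_diag X : X \in U -> exists k, forall a, X a a = k.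
Proof.
move: X; apply: scheme_ind => [|c i X [k IH]]; first by exists 0 => a; rewrite mxE.
have [->|i0] := eqVneq i ord0.
  by exists (c + k) => a; rewrite !mxE (scheme_id hA) mxE eqxx mulr1 IH.
by exists k => a; rewrite !mxE scheme_diag0// mulr0 add0r IH.
Qed.

Hypothesis hE : idempotent_basis A E.

Lemma idem_prim l : primitive_idempotent U (E l).
Proof. by have [_ /(_ l)] := hE. Qed.

Lemma idem_mem l : E l \in U. Proof. by have [[]] := idem_prim l. Qed.

Lemma idem_sq l : E l *m E l = E l. Proof. by have [[]] := idem_prim l. Qed.

Lemma idem_neq0 l : E l != 0. Proof. by have [] := idem_prim l. Qed.

Lemma idem_inj : injective E.
Proof.
have [_ _ /basis_free/free_uniq u] := hE; exact/injectiveP.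
Qed.

(** [E i *m E j] and [E i - E i *m E j] are orthogonal idempotents with sum [E i], so by primitivity
    the product is 0 or [E i]. A nonzero product would equal both [E l] and [E m], contradicting
    injectivity. *)
Lemma idem_orth l m : l != m -> E l *m E m = 0.
Proof.
move=> lm; apply/eqP; apply: contraNT lm => lm0; apply/eqP/idem_inj.
suff H (i j : 'I_d.+1) : E i *m E j != 0 -> E i = E i *m E j.
  by rewrite (H l m lm0) [RHS](H m l) scheme_span_comm ?idem_mem.
move=> ij0; have [_ _ /(_ (E i *m E j) (E i - E i *m E j))] := idem_prim i.
have C : E i *m E j = E j *m E i by rewrite scheme_span_comm ?idem_mem.
have S : E i *m E j *m (E i *m E j) = E i *m E j.
  by rewrite [in RHS]C mulmxA -(mulmxA _ (E j)) -C mulmxA idem_sq -mulmxA idem_sq.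
have L : E i *m (E i *m E j) = E i *m E j by rewrite mulmxA idem_sq.
have L' : E i *m E j *m E i = E i *m E j by rewrite -mulmxA -C L.
case=> //.
- by split=> //; rewrite scheme_span_mul// idem_mem.
- split; first by rewrite memvB ?scheme_span_mul ?idem_mem.
  by rewrite mulmxBl !mulmxBr idem_sq L L' S subrr subr0.
- by rewrite mulmxBr L' S subrr.
- by rewrite mulmxBl L S subrr.
- by rewrite addrC subrK.
- by move=> e0; rewrite e0 eqxx in ij0.
- by move=> /eqP; rewrite subr_eq0 => /eqP.
Qed.

(** Expand the identity in the basis; multiplying by [E m] shows that its coefficient there is 1. *)
Lemma idem_sum : \sum_l E l = 1%:M.
Proof.
have : 1%:M \in U by rewrite -(scheme_id hA) mem_scheme.
have [_ _ /span_basis spanE] := hE; rewrite /U -spanE => I_in.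
have [c cE] : exists c, 1%:M = \sum_l c l *: E l.
  move: I_in; move: (1%:M : 'M[R]_n); apply: span_ind => [|k u v].
    by exists (fun=> 0); rewrite big1// => l _; rewrite scale0r.
  move=> /fintype.imageP[i _ ->] [c ->]; exists (fun l => k * (l == i)%:R + c l).
  under [RHS]eq_bigr do rewrite scalerDl.
  rewrite big_split/= [X in _ = X + _](bigD1 i)//= eqxx mulr1.
  rewrite [X in _ = _ + X + _]big1 ?addr0//.
  by move=> l /negbTE ->; rewrite mulr0 scale0r.
rewrite [RHS]cE; apply: eq_bigr => m _.
have := mul1mx (E m); rewrite {1}cE mulmx_suml (bigD1 m)//= -scalemxAl idem_sq.
rewrite big1 ?addr0 => [/eqP|l lm]; last by rewrite -scalemxAl idem_orth// scaler0.
rewrite -{2}[E m]scale1r -subr_eq0 -scalerBl scaler_eq0 (negbTE (idem_neq0 m)) orbF.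
by rewrite subr_eq0 => /eqP ->; rewrite scale1r.
Qed.

(** A diagonal entry of a symmetric idempotent is the sum of squares of its row, so a nonzero row
    makes the common diagonal value positive. *)
Lemma idem_diag l : exists2 k, 0 < k & forall a, E l a a = k.
Proof.
have [k kE] := scheme_span_diag _ (idem_mem l); exists k => //.
have sq a : E l a a = \sum_b E l a b ^+ 2.
  rewrite -{1}idem_sq mxE; apply: eq_bigr => b _.
  by rewrite -{2}(scheme_span_sym _ (idem_mem l)) mxE expr2.
have /matrix0Pn[a [b ab]] := idem_neq0 l.
rewrite -(kE a) sq (bigD1 b)//= ltr_wpDr ?sumr_ge0// => [c _|]; first exact: sqr_ge0.
by rewrite lt_def sqr_ge0 sqrf_eq0 ab.
Qed.

Lemma idem_quad_ge0 l (x : 'cV[R]_n) : 0 <= (x^T *m E l *m x) 0 0.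
Proof.
have -> : x^T *m E l *m x = (E l *m x)^T *m (E l *m x).
  rewrite trmx_mul scheme_span_sym ?idem_mem// -mulmxA [in RHS]mulmxA.
  by rewrite -!mulmxA (mulmxA (E l)) idem_sq.
by rewrite mxE sumr_ge0// => a _; rewrite mxE -expr2 sqr_ge0.
Qed.

Variable P : 'M[R]_d.+1.
Hypothesis hP : first_eigenmatrix A E P.

Lemma eigenmatrixE i l : A i *m E l = P l i *: E l.
Proof.
rewrite hP mulmx_suml (bigD1 l)//= -scalemxAl idem_sq big1 ?addr0// => m ml.
by rewrite -scalemxAl idem_orth// scaler0.
Qed.

(** Compare a diagonal entry on both sides of the eigenvalue equation for [E ord0], a positive
    multiple of the all-ones matrix. *)
Lemma eigenmatrix_row0 i k (a : 'I_n) : (forall b, \sum_c A i b c = k) -> P ord0 i = k.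
Proof.
move=> hk; have /matrixP/(_ a a) := eigenmatrixE i ord0.
have [-> _ _] := hE; rewrite !mxE; under eq_bigr do rewrite mxE.
rewrite -mulr_suml hk => /mulIf -> //.
by rewrite invr_eq0 pnatr_eq0; case: n a => -[].
Qed.

End Scheme.

(** * The spectral upper bound and the rounding lower bound for [qp] *)

Lemma bigmax_attained (R : realType) (d : nat) (F : 'I_d.+1 -> R) :
  exists l, \big[Num.max/F ord0]_(l < d.+1) F l = F l.
Proof.
elim/big_ind: _ => [|x y [i ->] [j ->]|i _]; [by exists ord0| |by exists i].
by rewrite /Num.max; case: ifP => _; [exists j|exists i].
Qed.

Section Bounds.
Context {R : realType} {V : finType} (G1 G2 : sgraph V) (k1 k2 : nat).
Hypotheses (hk1 : regular G1 k1) (hk2 : regular G2 k2).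
Notation n := #|V|.

(** [X] is left arbitrary to cover both the products of signs in the upper bound and the Gram matrix
    in the lower bound. *)
Lemma sum_adjmx_regular (X : 'I_n -> 'I_n -> R) :
  \sum_a \sum_b (adjmx R G1 a b * (1 - X a b) + adjmx R G2 a b * (1 + X a b)) =
  n%:R * (k1%:R + k2%:R) +
  \sum_a \sum_b (adjmx R G2 - adjmx R G1) a b * X a b.
Proof.
rewrite (_ : n%:R * _ = \sum_(a < n) (k1%:R + k2%:R)); last first.
  by rewrite sumr_const card_ord mulr_natl.
rewrite -big_split/=; apply: eq_bigr => a _.
rewrite -(regular_row_sum (R := R) _ _ a hk1) -(regular_row_sum (R := R) _ _ a hk2).
rewrite -!big_split/=; apply: eq_bigr => b _; rewrite !mxE; ring.
Qed.

Variables (d : nat) (A E : 'I_d.+1 -> 'M[R]_n) (P : 'M[R]_d.+1) (i1 i2 : 'I_d.+1).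
Hypotheses (hA : assoc_scheme A) (hA1 : A i1 = adjmx R G1) (hA2 : A i2 = adjmx R G2).
Hypotheses (hE : idempotent_basis A E) (hP : first_eigenmatrix A E P).

Let diffE : adjmx R G2 - adjmx R G1 = \sum_l (P l i2 - P l i1) *: E l.
Proof.
rewrite -hA1 -hA2 (hP i1) (hP i2) -sumrB.
by apply: eq_bigr => l _; rewrite scalerBl.
Qed.

Lemma qp_obj_le_eigen (x : V -> R) (lam : R) : (forall v, x v ^+ 2 = 1) ->
  (forall l, P l i2 - P l i1 <= lam) ->
  qp_obj G1 G2 x <= n%:R / 2 * (k1%:R + k2%:R + lam).
Proof.
move=> x1 hlam.
suff : 2 * qp_obj G1 G2 x <= n%:R * (k1%:R + k2%:R) + n%:R * lam by lra.
rewrite qp_obj_adjmx (sum_adjmx_regular (fun a b => x (enum_val a) * x (enum_val b))).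
rewrite lerD2l; pose y : 'cV[R]_n := \col_a x (enum_val a).
have quadE (M : 'M[R]_n) :
    \sum_a \sum_b M a b * (x (enum_val a) * x (enum_val b)) = (y^T *m M *m y) 0 0.
  rewrite -mulmxA mxE; apply: eq_bigr => a _; rewrite !mxE mulr_sumr.
  by apply: eq_bigr => b _; rewrite mxE; ring.
(* The idempotents sum to the identity, so the weights of [y] on the eigenspaces add up to its
   squared norm. *)
have yy : \sum_l (y^T *m E l *m y) 0 0 = n%:R.
  rewrite -summxE -mulmx_suml -mulmx_sumr (idem_sum _ _ hA hE) mulmx1 mxE.
  under eq_bigr do rewrite !mxE -expr2 x1.
  by rewrite sumr_const card_ord.
rewrite quadE diffE mulmx_sumr mulmx_suml summxE -yy mulr_suml.
apply: ler_sum => l _; rewrite -scalemxAr -scalemxAl mxE [leRHS]mulrC.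
by apply: ler_wpM2r => //; exact: (idem_quad_ge0 _ _ hA hE).
Qed.

(** Round the columns of [E l] divided by the square root of its diagonal value [k]. They are unit
    vectors, with Gram matrix [k^-1 *: E l] because [E l] is a symmetric idempotent. *)
Lemma alpha_GW_eigen_le_qp l :
  alpha_GW R * (n%:R / 2 * (k1%:R + k2%:R + (P l i2 - P l i1))) <= qp R G1 G2.
Proof.
have [k k0 kE] := idem_diag _ _ hA hE l.
pose B := (Num.sqrt k)^-1 *: E l.
have BB : B^T *m B = k^-1 *: E l.
  rewrite /B -scalemxAr linearZ/= -scalemxAl scalerA -expr2 exprVn.
  rewrite sqr_sqrtr ?(ltW k0)//.
  by rewrite (scheme_span_sym _ hA) ?(idem_mem _ _ hE)// (idem_sq _ _ hE).
have [_ qpM] := qp_max R G1 G2.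
have := @hyperplane_rounding R _ _ B (adjmx R G1) (adjmx R G2) (qp R G1 G2).
rewrite BB (sum_adjmx_regular (fun a b => (k^-1 *: E l) a b)) => {}H.
(* By symmetry of [E l] the sum is a trace of [(adjmx R G2 - adjmx R G1) *m E l] over [k], each
   diagonal entry contributing the eigenvalue difference. *)
have XE : \sum_a \sum_b (adjmx R G2 - adjmx R G1) a b * (k^-1 *: E l) a b =
    n%:R * (P l i2 - P l i1).
  rewrite -[n in RHS]card_ord mulr_natl -sumr_const; apply: eq_bigr => a _.
  transitivity (k^-1 * ((adjmx R G2 - adjmx R G1) *m E l) a a).
    rewrite mxE mulr_sumr; apply: eq_bigr => b _.
    by rewrite -[in RHS](scheme_span_sym _ hA _ (idem_mem _ _ hE l)) !mxE; ring.
  rewrite mulmxBl -hA1 -hA2 !(eigenmatrixE _ _ hA hE _ hP) -scalerBl mxE kE.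
  by rewrite mulrCA mulVf ?mulr1 ?gt_eqF.
rewrite XE in H.
have -> : alpha_GW R * (n%:R / 2 * (k1%:R + k2%:R + (P l i2 - P l i1))) =
  alpha_GW R / 2 * (n%:R * (k1%:R + k2%:R) + n%:R * (P l i2 - P l i1)) by field.
apply: H => [a|a b|a b|x].
- by rewrite mxE kE mulVf// gt_eqF.
- exact: adjmx_ge0.
- exact: adjmx_ge0.
(* Zero goes to 1, as in the tests [0 <= x a]. One minus the product of two such signs is twice the
   indicator of separation, hence the factor 2 below. *)
pose s (r : R) : R := if 0 <= r then 1 else -1.
pose z v := s (x (enum_rank v)).
apply: le_trans (qpM z _); last first.
  by move=> v; rewrite /z /s; case: ifP => _; rewrite ?sqrrN expr1n.
rewrite -(ler_pM2l (ltr0n R 2)) qp_obj_adjmx mulr_sumr ler_sum// => a _.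
rewrite mulr_sumr ler_sum// => b _; rewrite /z !enum_valK /s.
by case: (0 <= x a); case: (0 <= x b) => /=; lra.
Qed.
End Bounds.

(** * Positivity of the denominator and the two inequalities for the ratio *)

Theorem corollary8 (R : realType) (V : finType) (G1 G2 : sgraph V)
    (d : nat) (hd : (2 <= d)%N) (A E : 'I_d.+1 -> 'M[R]_#|V|)
    (P : 'M[R]_d.+1) (k1 k2 : nat)
    (hA : assoc_scheme A)
    (hA1 : A (inord 1) = adjmx R G1) (hA2 : A (inord 2) = adjmx R G2)
    (hE : idempotent_basis A E) (hP : first_eigenmatrix A E P)
    (hk1 : regular G1 k1) (hk2 : regular G2 k2) :
  alpha_GW R <=
    qp R G1 G2 /
      (#|V|%:R / 2 *
        ((k1%:R + k2%:R) +
         \big[Num.max/(P ord0 (inord 2) - P ord0 (inord 1))]_(l < d.+1)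
            (P l (inord 2) - P l (inord 1)))) <= 1.
Proof.
set lam := \big[_/_]_(l < _) _.
have [l lamE] : exists l, lam = P l (inord 2) - P l (inord 1).
  exact: (bigmax_attained _ _ (fun l => P l (inord 2) - P l (inord 1))).
have lam_ge m : P m (inord 2) - P m (inord 1) <= lam.
  exact: (le_bigmax _ (fun l => P l (inord 2) - P l (inord 1))).
(* A nonzero entry of [A (inord 2)] provides a vertex and makes the degree [k2] positive. *)
have [a [b ab]] : exists a b, A (inord 2) a b != 0.
  by have /matrix0Pn := scheme_neq0 hA (inord 2).
have k2_gt0 : 0 < k2%:R :> R.
  rewrite -(regular_row_sum (R := R) _ _ a hk2) (bigD1 b)//= ltr_wpDr//.
    by apply: sumr_ge0 => c _; exact: adjmx_ge0.
  by rewrite -hA2 lt_def ab hA2 adjmx_ge0.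
(* The index 0 contributes the difference of the degrees, so [k1 + k2 + lam] is at least [2 * k2],
   hence positive. *)
have lam0 : k2%:R - k1%:R <= lam.
  apply: le_trans (lam_ge ord0).
  rewrite (eigenmatrix_row0 _ _ hA hE _ hP _ k2%:R a); last first.
    by move=> c; rewrite hA2 (regular_row_sum _ _ _ hk2).
  rewrite (eigenmatrix_row0 _ _ hA hE _ hP _ k1%:R a)// => c.
  by rewrite hA1 (regular_row_sum _ _ _ hk1).
have n_gt0 : 0 < #|V|%:R :> R by rewrite ltr0n (leq_ltn_trans _ (ltn_ord a)).
have D_gt0 : 0 < #|V|%:R / 2 * (k1%:R + k2%:R + lam).
  by rewrite mulr_gt0 ?divr_gt0//; have := ler0n R k1; lra.
rewrite ler_pdivlMr// ler_pdivrMr// mul1r; apply/andP; split.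
  by rewrite lamE (alpha_GW_eigen_le_qp _ _ _ _ hk1 hk2 _ _ _ _ _ _ hA hA1 hA2 hE hP).
have [[x x1 <-] _] := qp_max R G1 G2.
exact: (qp_obj_le_eigen _ _ _ _ hk1 hk2 _ _ _ _ _ _ hA hA1 hA2 hE hP).
Qed.
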